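(* Let $\mathcal{T}$ be a tangle, and suppose there is some positive integer $n'$ such that $\mathcal{T}$ fails to guarantee envy-free connected allocations for $n'$ agents with monotone continuous valuations. Let $t$ be the gap threshold of $\mathcal{T}$. Then for each positive integer $k$ and each integer $n>t$, eventually all graphs in the topological class $\mathcal{G}(\mathcal{T})$ fail to guarantee contiguous EF$k_{\mathrm{outer}}$ allocations for $n$ agents.
   Context: A tangle is a connected topological space obtained by taking finitely many disjoint copies of $[0,1]$ and identifying some of their endpoints (quotient topology). Points of degree $1$ or $\ge3$ (degree = number of rays from the point in a small neighborhood) are singular; an edge is a connected component of the complement of the singular points. A valuation on $\mathcal{T}$ assigns a nonnegative real $\nu(X)$ to each connected $X\subseteq\mathcal{T}$; it is monotone continuous if (1) $\nu(\emptyset)=0$ and $\nu(X)\le\nu(Y)$ for connected $X\subseteq Y$; and (2) identifying each of the $m$ edges $e_i$ with a copy $[0,1]_i$ and letting $X(z)$, for $z=(x_1,y_1,\dots,x_m,y_m)$, be the closed set whose intersection with $e_i$ corresponds to $[x_i,y_i]\cap[0,1]_i$, the map $z\mapsto\nu(X(z))$ restricted to $z$ with $X(z)$ closed and connected is continuous. $\mathcal{T}$ guarantees envy-free connected allocations for $n$ agents if for all monotone continuous $\nu_1,\dots,\nu_n$ there exist pairwise disjoint connected $T_1,\dots,T_n$ with union $\mathcal{T}$ and $\nu_i(T_i)\ge\nu_i(T_j)$ for all $i,j$. A set $X\subseteq\mathcal{T}$ with $t$ elements is a gap $\ge2$ cutset of cardinality $t$ if $\mathcal{T}\setminus X$ has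 at least $t+2$ connected components. The gap threshold of $\mathcal{T}$ is the smallest $t$ for which a gap $\ge2$ cutset of cardinality $t$ exists ($\infty$ if none exists). The multigraph $G_{\mathcal{T}}$ has the singular points as vertices and one edge for each edge of $\mathcal{T}$ joining the singular points at its ends (loops and parallel edges allowed). A subdivision of a multigraph is obtained by inserting zero or more new degree-$2$ vertices along edges; $\mathcal{G}(\mathcal{T})$ is the collection of all subdivisions of $G_{\mathcal{T}}$. $H\succeq G$ means $H$ is isomorphic to a subdivision of $G$. A property holds for eventually all members of $\mathcal{G}(\mathcal{T})$ if the set of members having it contains $\{K\in\mathcal{G}(\mathcal{T}):K\succeq H\}$ for some $H\in\mathcal{G}(\mathcal{T})$. For a (multi)graph $G=(V,E)$ and $n$ agents, each agent $i$ has a monotone valuation $\nu_i$ on subsets of $V$ ($\nu_i(\emptyset)=0$, $\nu_i(X)\le\nu_i(Y)$ for $X\subseteq Y$). A contiguous allocation is a tuple $(A_1,\dots,A_n)$ of pairwise disjoint subsets of $V$ with union $V$, each inducing a connected subgraph. It is EF$k_{\mathrm{outer}}$ if for every $i\ne j$ there is $S\subseteq A_j$ with $|S|\le k$ such that $A_j\setminus S$ induces a connected subgraph and $\nu_i(A_i)\ge\nu_i(A_j\setminus S)$. $G$ guarantees contiguous EF$k_{\mathrm{outer}}$ allocations for $n$ agents if such an allocation exists for every choice of monotone valuations $\nu_1,\dots,\nu_n$. *)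

(* Defs.v *)
From HB Require Import structures.
From mathcomp Require Import all_boot all_order all_algebra.
From mathcomp Require Import all_classical all_reals all_analysis.
Set Implicit Arguments.
Unset Strict Implicit.
Unset Printing Implicit Defensive.
Import Order.TTheory GRing.Theory Num.Theory.
Import numFieldNormedType.Exports.
Local Open Scope classical_set_scope.
Local Open Scope ring_scope.
Local Open Scope quotient_scope.

Section Gluing.
Context (R : realType) (m : nat).

Definition unit_copies := {i : 'I_m & set_type (`[0, 1]%classic : set R)}.

Lemma zero_in01 : (0 : R) \in (`[0, 1]%classic : set R).
Proof. by rewrite inE /= in_itv /= lexx ler01. Qed.

Lemma one_in01 : (1 : R) \in (`[0, 1]%classic : set R).
Proof. by rewrite inE /= in_itv /= lexx ler01. Qed.

(* (i, false) is the end 0 of the i-th copy of [0, 1], (i, true) its end 1 *)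
Definition copy_end (a : 'I_m * bool) : unit_copies :=
  existT _ a.1 (if a.2 then SigSub one_in01 else SigSub zero_in01).

Lemma copy_end_inj : injective copy_end.
Proof.
move=> [i b] [j c] e.
have := congr1 (fun x : unit_copies => (projT1 x, val (projT2 x))) e.
by case: b c {e} => -[] //= [-> ] // /eqP; rewrite ?oner_eq0 // eq_sym oner_eq0.
Qed.

Variable glue : equiv_rel ('I_m * bool).

Definition glue_rel (x y : unit_copies) : bool :=
  `[< x = y \/ exists a b, [/\ glue a b, x = copy_end a & y = copy_end b] >].

Lemma glue_rel_refl : reflexive glue_rel.
Proof. by move=> x; apply/asboolP; left. Qed.

Lemma glue_rel_sym : symmetric glue_rel.
Proof.
move=> x y; apply: asbool_equiv_eq; split=> -[->|[a [b [gab -> ->]]]];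
  by [left | right; exists b, a; rewrite generic_quotient.equiv_sym].
Qed.

Lemma glue_rel_trans : transitive glue_rel.
Proof.
move=> y x z /asboolP[-> //|[a [b [gab -> ->]]]] /asboolP[<-|[c [d [gcd]]]].
  by apply/asboolP; right; exists a, b.
move=> /copy_end_inj eb ->; apply/asboolP; right; exists a, d; split=> //.
rewrite -eb in gcd; exact: generic_quotient.equiv_trans gab gcd.
Qed.

Canonical glue_equiv := EquivRel glue_rel glue_rel_refl glue_rel_sym glue_rel_trans.

Definition glued_space : topologicalType :=
  quotient_topology {eq_quot glue_equiv}.

Definition glued_end (a : 'I_m * bool) : glued_space :=
  \pi_{eq_quot glue_equiv} (copy_end a).

End Gluing.

Record tangle (R : realType) := Tangle {
  ncopies : nat;
  gluing : equiv_rel ('I_ncopies * bool);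
  ncopies_gt0 : (0 < ncopies)%N;
  tangle_connected : connected [set: glued_space R gluing] }.

Definition tangle_space (R : realType) (T : tangle R) : topologicalType :=
  glued_space R (gluing T).
Coercion tangle_space : tangle >-> topologicalType.

Definition components (X : topologicalType) (A : set X) : set (set X) :=
  [set connected_component A x | x in A].

Section Tangles.
Context {R : realType} (T : tangle R).

(* Every end of a copy glued to p sends out one ray from p; a point that is
   not the image of an end is interior to a copy and has two rays. *)
Definition degree (p : T) : nat :=
  let d := #|[pred a | `[< glued_end R (gluing T) a = p >]]| in
  if d == 0%N then 2%N else d.

Definition singular : set T := [set p | degree p = 1%N \/ (3 <= degree p)%N].

(* The points at which the tangle is cut into edges: the singular points. The
   circle is the only tangle with no singular point; there, one arbitrary
   point plays this role. *)
Definition node_set (S : set T) : Prop :=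
  (singular !=set0 /\ S = singular) \/
  (singular = set0 /\ exists p, S = [set p]).

(* The edges are the components of ~` S. The closure of an edge may be a loop,
   so g i need not be injective at the ends of [0, 1]; the values of g i
   outside [0, 1] are irrelevant. *)
Definition edge_parametrization (S : set T) (m : nat) (g : 'I_m -> R -> T) :=
  [/\ forall i, {within `[0, 1]%classic, continuous (g i)},
      forall i, set_inj `]0, 1[%classic (g i),
      forall i, S (g i 0) /\ S (g i 1) &
      set_bij [set: 'I_m] (components (~` S))
        (fun i => g i @` `]0, 1[%classic)].

(* X(z) for z = (x, y); it contains an end of an edge when [x_i, y_i] does, and
   it is empty when all these intervals miss [0, 1]. *)
Definition closed_piece (m : nat) (g : 'I_m -> R -> T)
    (z : 'rV[R]_m * 'rV[R]_m) : set T :=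
  \bigcup_(i in [set: 'I_m])
    g i @` (`[z.1 ord0 i, z.2 ord0 i]%classic `&` `[0, 1]%classic).

(* Only the values of nu on connected sets are meaningful; the empty set is
   connected. The continuity condition does not depend on the parametrization g
   (except that, on the circle, g also selects the cut point), hence the
   universal quantifier. *)
Definition monotone_continuous (nu : set T -> R) : Prop :=
  [/\ forall X, connected X -> 0 <= nu X,
      nu set0 = 0,
      forall X Y, connected X -> connected Y -> X `<=` Y -> nu X <= nu Y &
      forall (S : set T) (m : nat) (g : 'I_m -> R -> T),
        node_set S -> edge_parametrization S g ->
        {within [set z | closed (closed_piece g z) /\
                         connected (closed_piece g z)],
          continuous (fun z => nu (closed_piece g z))}].

Definition guarantees_EF (n : nat) : Prop :=
  forall nu : 'I_n -> set T -> R, (forall i, monotone_continuous (nu i)) ->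
  exists A : 'I_n -> set T,
    [/\ forall i, connected (A i), trivIset setT A,
        \bigcup_(i in [set: 'I_n]) A i = setT &
        forall i j, nu i (A j) <= nu i (A i)].

Definition gap2_cutset (t : nat) (X : set T) : Prop :=
  (X #= `I_t)%card /\ (`I_t.+2 #<= components (~` X))%card.

(* The smallest t, and +oo if there is none. *)
Definition gap_threshold : \bar R :=
  ereal_inf [set (t%:R)%:E | t in [set t : nat | exists X, gap2_cutset t X]].

End Tangles.

(* The order of the two ends of an edge is immaterial. *)
Record multigraph := Multigraph {
  vert : finType;
  edge : finType;
  src : edge -> vert;
  tgt : edge -> vert }.

Definition ends (G : multigraph) (e : edge G) : {set vert G} :=
  [set src e; tgt e]%SET.

Definition multigraph_iso (G H : multigraph) : Prop :=
  exists (f : vert G -> vert H) (h : edge G -> edge H),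
    [/\ bijective f, bijective h & forall e, f @: ends e = ends (h e)].

Section Subdivision.
Context (G : multigraph) (l : edge G -> nat).

Definition subdivision_vert : finType := (vert G + {e : edge G & 'I_(l e)})%type.

(* The j-th vertex, 0 <= j <= l e + 1, on the path that replaces e. *)
Definition subdivision_node (e : edge G) (j : nat) : subdivision_vert :=
  if j == 0%N then inl (src e)
  else if insub j.-1 : option 'I_(l e) is Some i then
    inr (Tagged (fun e => 'I_(l e)) i)
  else inl (tgt e).

(* Insert l e new vertices along each edge e. *)
Definition subdivision : multigraph := {|
  vert := subdivision_vert;
  edge := {e : edge G & 'I_(l e).+1};
  src := fun u => subdivision_node (tag u) (tagged u);
  tgt := fun u => subdivision_node (tag u) (tagged u).+1 |}.

End Subdivision.

(* H \succeq G *)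
Definition refines (H G : multigraph) : Prop :=
  exists l : edge G -> nat, multigraph_iso H (subdivision l).

Section TopologicalClass.
Context {R : realType} (T : tangle R).

(* G is (isomorphic to) G_T. The set closure (c e) `\` c e consists of the
   points at the ends of the edge c e (a single one for a loop). *)
Definition is_tangle_graph (G : multigraph) : Prop :=
  exists (S : set T) (p : vert G -> T) (c : edge G -> set T),
    [/\ node_set S,
        set_bij [set: vert G] S p,
        set_bij [set: edge G] (components (~` S)) c &
        forall e, [set p (src e); p (tgt e)] = closure (c e) `\` c e].

Definition topological_class (K : multigraph) : Prop :=
  exists2 G, is_tangle_graph G & refines K G.

Definition eventually_all (P : multigraph -> Prop) : Prop :=
  exists2 H, topological_class H &
    forall K, topological_class K -> refines K H -> P K.

End TopologicalClass.

Section GraphAllocations.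
Context (G : multigraph).

Definition adjacent (u v : vert G) : bool :=
  [exists e : edge G, ends e == [set u; v]%SET].

(* As for subsets of tangles, the empty set counts as connected. *)
Definition induces_connected (A : {set vert G}) : Prop :=
  {in A &, forall u v,
    connect [rel x y | [&& x \in A, y \in A & adjacent x y]] u v}.

Definition contiguous_allocation (n : nat) (A : 'I_n -> {set vert G}) : Prop :=
  [/\ forall i, induces_connected (A i),
      forall i j, i != j -> (A i :&: A j)%SET = finset.set0 &
      (\bigcup_i A i)%SET = [set: vert G]%SET].

Context {R : realType}.

Definition monotone_valuation (nu : {set vert G} -> R) : Prop :=
  nu finset.set0 = 0 /\
  forall X Y : {set vert G}, X \subset Y -> nu X <= nu Y.

Definition EFk_outer (k n : nat) (nu : 'I_n -> {set vert G} -> R)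
    (A : 'I_n -> {set vert G}) : Prop :=
  forall i j, i != j ->
  exists S : {set vert G},
    [/\ S \subset A j, (#|S| <= k)%N,
        induces_connected (A j :\: S)%SET &
        nu i (A j :\: S)%SET <= nu i (A i)].

End GraphAllocations.

Definition guarantees_EFk_outer (R : realType) (k n : nat) (G : multigraph) :=
  forall nu : 'I_n -> {set vert G} -> R, (forall i, monotone_valuation (nu i)) ->
  exists A : 'I_n -> {set vert G},
    contiguous_allocation A /\ EFk_outer k nu A.

(* Main.v *)
(* A degree-2 point of a cutset can be dropped: putting it back merges at most
   two components. So a gap >= 2 cutset may be taken to consist of t < n singular
   points, which are vertices of G_T, and each of the at least t + 2 components
   it leaves contains a whole edge of T. In a fine subdivision these edges carry
   long paths, on which all agents count the same sets of vertices, sized so that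
   no allocation gives nearly equal shares (see [no_EFk_outer_of_cut]).
   That G_T exists (an edge of T has at most two ends) is the same merging
   argument, starting from the copies of ]0, 1[. *)

Require Import Defs.
From mathcomp Require Import all_boot all_order all_algebra.
From mathcomp Require Import all_classical all_reals all_analysis.
From mathcomp Require Import zify lra.

Set Implicit Arguments.
Unset Strict Implicit.
Unset Printing Implicit Defensive.
Import Order.TTheory GRing.Theory Num.Theory.
Import numFieldNormedType.Exports.

(** * Graphs with a cut *)

Section GraphAllocations.
Local Open Scope nat_scope.

Lemma sum_card_setI (V : finType) (n : nat) (A : 'I_n -> {set V}) (B : {set V}) :
  (forall i j, i != j -> A i :&: A j = finset.set0)%SET ->
  (\sum_i #|A i :&: B| = #|(\bigcup_i A i) :&: B|)%SET.
Proof.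
move=> dA; rewrite big_distrl /= -[RHS]sum1_card.
rewrite partition_disjoint_bigcup => [|i j /dA dij].
  by apply: eq_bigr => i _; rewrite sum1_card.
by rewrite -finset.setI_eq0 finset.setIACA dij finset.set0I.
Qed.

Lemma induces_connected_const (K : multigraph) (L : Type) (lam : vert K -> L)
    (A : {set vert K}) :
  induces_connected A ->
  {in A &, forall u v, Defs.adjacent u v -> lam u = lam v} ->
  {in A &, forall u v, lam u = lam v}.
Proof.
move=> cA lamA u v uA vA; have /connectP[p pth ->] := cA u v uA vA.
elim: p u {uA} pth => //= w p IHp u /andP[/and3P[uA wA uw] /IHp <-].
exact: lamA.
Qed.

(** Give every agent the same valuation, the number of vertices of [U] in a set. Deleting at most
    [k] vertices lowers it by at most [k], which bounds the difference of any two shares. *)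
Lemma guarantees_EFk_outer_card (R : realType) (K : multigraph) (k n : nat)
    (U : {set vert K}) :
  guarantees_EFk_outer R k n K ->
  exists2 A : 'I_n -> {set vert K}, contiguous_allocation A &
    forall i j, #|A j :&: U| <= #|A i :&: U| + k.
Proof.
move=> /(_ (fun _ A => #|A :&: U|%SET%:R)%R) [].
  move=> i; split=> [|X Y XY]; first by rewrite finset.set0I cards0.
  by rewrite ler_nat subset_leq_card // finset.setSI.
move=> A [cA efA]; exists A => // i j.
have [->|/efA[S [_ Sk _]]] := eqVneq i j; first exact: leq_addr.
rewrite ler_nat => le_ij; apply: leq_trans (leq_add le_ij Sk).
rewrite -cardsUI; apply: leq_trans (leq_addr _ _); apply: subset_leq_card.
by apply/fintype.subsetP => v; rewrite !inE; case: (v \in S) => /=; rewrite ?orbT ?orbF.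
Qed.

(* One part of weight (n - t - 1/(t+2)) and t + 1 parts of weight
   (t + 1)/(t + 2), in units of the average share of an agent: at least
   [n - t] agents get no vertex of [C], each of these is confined to one part,
   and the first part has room for at most n - t - 1 of them. *)
Lemma no_EFk_outer_of_cut (R : realType) (K : multigraph) (L : Type)
    (lam : vert K -> L) (C : {set vert K}) (k n t : nat)
    (D : 'I_t.+2 -> {set vert K}) (l : 'I_t.+2 -> L) :
  t < n -> #|C| <= t -> injective l ->
  (forall u v, u \notin C -> v \notin C -> Defs.adjacent u v -> lam u = lam v) ->
  (forall j v, v \in D j -> lam v = l j) ->
  (forall j, n * t.+2 * (n * k).+1 <= #|D j|) ->
  ~ guarantees_EFk_outer R k n K.
Proof.
(* [M] exceeds the total slack [n * k] of all agents, so the first part, one [M] short of [n - t]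
   average shares, cannot be stretched to serve [n - t] agents. *)
move=> tn Ct l_inj lamC lamD szD; set M := (n * k).+1.
pose sz (j : 'I_t.+2) := if j == ord0 then ((n - t) * t.+2).-1 * M else t.+1 * M.
have /fin_all_exists2[W WD szW] (j : 'I_t.+2) :
    exists2 W : {set vert K}, W \subset D j & #|W| = sz j.
  have : sz j <= #|D j|.
    apply: leq_trans (szD j); rewrite /sz -/M.
    by case: ifP => _; rewrite leq_mul2r; apply/orP; right; nia.
  case/card_geqP => s [us ss sD]; exists [set:: s]%SET.
    by apply/fintype.subsetP => v; rewrite inE => /sD.
  by rewrite cardsE (card_uniqP us).
have disW i j : i != j -> (W i :&: W j = finset.set0)%SET.
  move=> /eqP ij; apply/finset.setP => v; rewrite !inE; apply/negP => /andP[vi vj].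
  apply: ij; apply: l_inj.
  by rewrite -(lamD _ _ (fintype.subsetP (WD i) v vi)) (lamD _ _ (fintype.subsetP (WD j) v vj)).
set U := (\bigcup_j W j)%SET.
(* In units of [M]: (n - t)(t + 2) - 1 + (t + 1)(t + 1) = n(t + 2). *)
have szU : #|U| = n * (t.+2 * M).
  rewrite -[U]finset.setIT -sum_card_setI // big_ord_recl finset.setIT szW /sz eqxx /=.
  rewrite (eq_bigr (fun=> t.+1 * M)) => [|i _]; last by rewrite finset.setIT szW.
  by rewrite sum_nat_const card_ord; nia.
move=> /(guarantees_EFk_outer_card U)[A [cA disA covA] efA].
have sumA B : \sum_i #|A i :&: B|%SET = #|B| by rewrite sum_card_setI // covA finset.setTI.
(* Averaging: every share is at most that of [i] plus [k], and the [n] shares sum to [#|U|]. *)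
have lowA i : t.+2 * M <= #|A i :&: U|%SET + k.
  rewrite -(leq_pmul2l (leq_ltn_trans (leq0n t) tn)) -szU -sumA.
  rewrite -[X in X * _]card_ord -sum_nat_const.
  by apply: leq_sum => j _; apply: efA.
pose P := [set i | A i :&: C == finset.set0]%SET.
(* The shares are disjoint, so each agent outside [P] uses up a vertex of [C] of its own. *)
have szP : n - t <= #|P|.
  rewrite leq_subLR -{1}[n]card_ord -(cardsC P) addnC leq_add2r.
  apply: leq_trans Ct; rewrite -(sumA C) -sum1_card big_mkcond /=.
  by apply: leq_sum => i _; rewrite !inE -card_gt0; case: ifP.
(* A share avoiding [C] carries a single label and so meets a single part. A part other than the
   first has [t.+1 * M] vertices, fewer than the [t.+2 * M - k] required by [lowA]. *)
have inW0 i : i \in P -> #|A i :&: U|%SET = #|A i :&: W ord0|%SET.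
  rewrite inE => /eqP AC0.
  have notC u : u \in A i -> u \notin C.
    by move=> ui; apply/negP => uC; have := finset.in_set0 u; rewrite -AC0 inE ui uC.
  have lamA := induces_connected_const (cA i) (lam := lam)
     (fun u v ui vi => lamC u v (notC u ui) (notC v vi)).
  have : 0 < #|A i :&: U|%SET by have := lowA i; rewrite /M; nia.
  rewrite card_gt0 => /set0Pn[v]; rewrite inE => /andP[vi /bigcupP[j _ vj]].
  have AU : (A i :&: U = A i :&: W j)%SET.
    apply/finset.setP => u; rewrite !inE; apply: andb_id2l => ui.
    apply/idP/idP => [/bigcupP[j' _ uj']|uj]; last by apply/bigcupP; exists j.
    suff -> : j = j' by [].
    apply: l_inj; rewrite -(lamD _ _ (fintype.subsetP (WD j) v vj)).
    by rewrite -(lamD _ _ (fintype.subsetP (WD j') u uj')); apply: lamA.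
  rewrite AU; case: (eqVneq j ord0) => [->//|j0].
  have := lowA i; rewrite AU.
  have := subset_leq_card (finset.subsetIr (A i) (W j)).
  by rewrite szW /sz (negPf j0) /M; nia.
(* This upper bound by the first part and the lower bound from [lowA] combine with [szP] to
   [M <= n * k], a contradiction. *)
have : \sum_(i in P) (#|A i :&: W ord0|%SET + k) <= ((n - t) * t.+2).-1 * M + n * k.
  rewrite big_split /= leq_add //.
    have := sumA (W ord0); rewrite szW /sz eqxx => <-.
    by rewrite big_mkcond /=; apply: leq_sum => i _; case: ifP.
  by rewrite sum_nat_const leq_mul2r -[X in _ <= X]card_ord max_card orbT.
have : \sum_(i in P) (t.+2 * M) <= \sum_(i in P) (#|A i :&: W ord0|%SET + k).
  by apply: leq_sum => i iP; rewrite -inW0.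
rewrite sum_nat_const => H1 H2.
have := leq_trans (leq_trans (leq_mul szP (leqnn (t.+2 * M))) H1) H2.
rewrite /M; nia.
Qed.


(* [mu e] names the piece containing the edge [e] once the cut vertices [C] are
   removed; a vertex outside [C] lies in the piece of each of its edges. *)
Definition cut_labelling (K : multigraph) (L : Type) (C : {set vert K})
    (lam : vert K -> L) (mu : edge K -> L) : Prop :=
  forall e v, v \in ends e -> v \notin C -> lam v = mu e.

Lemma cut_labelling_adjacent (K : multigraph) (L : Type) (C : {set vert K})
    (lam : vert K -> L) (mu : edge K -> L) (u v : vert K) :
  cut_labelling C lam mu -> u \notin C -> v \notin C -> Defs.adjacent u v ->
  lam u = lam v.
Proof.
move=> clab uC vC /fintype.existsP[e /eqP eE].
by rewrite (clab e u) ?(clab e v) // eE !inE eqxx ?orbT.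
Qed.

(** The cut vertices stay the same: a new vertex, like each piece of a divided edge, inherits the
    label of the edge it lies on. *)
Lemma cut_labelling_subdivision (G : multigraph) (l : edge G -> nat) (L : Type)
    (C : {set vert G}) (lam : vert G -> L) (mu : edge G -> L) :
  cut_labelling C lam mu ->
  @cut_labelling (subdivision l) L [set inl v | v in C]%SET
    (fun w => match w with inl v => lam v | inr u => mu (tag u) end)
    (fun u => mu (tag u)).
Proof.
move=> clab [e i] w.
have node j : w = subdivision_node l e j -> w \notin [set inl v | v in C]%SET ->
    match w with inl v => lam v | inr u => mu (tag u) end = mu e.
  have end_e v : v \in ends e -> inl v \notin [set inl v | v in C]%SET -> lam v = mu e.
    by move=> ve; rewrite mem_imset => [/(clab _ _ ve)//|x y []//].
  rewrite /subdivision_node; case: ifP => _ => [->|].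
    by apply: end_e; rewrite !inE eqxx.
  case: insub => [j' ->//|->].
  by apply: end_e; rewrite !inE eqxx orbT.
by rewrite !inE => /orP[] /eqP /node.
Qed.

Lemma multigraph_iso_refl (G : multigraph) : multigraph_iso G G.
Proof.
exists id, id; split=> [||e]; [by exists id..|].
exact: imset_id.
Qed.

Lemma cut_labelling_iso (G H : multigraph) (f : vert G -> vert H)
    (h : edge G -> edge H) (L : Type) (C : {set vert H}) (lam : vert H -> L)
    (mu : edge H -> L) :
  (forall e, f @: ends e = ends (h e)) -> cut_labelling C lam mu ->
  cut_labelling (f @^-1: C) (lam \o f) (mu \o h).
Proof.
move=> fh clab e v ve; rewrite inE; apply: clab.
by rewrite -fh; apply: imset_f.
Qed.

(** The large parts come from the edges [E j]: each receives enough new vertices in the subdivision,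
    and these survive in every refinement [K], which only adds more. *)
Lemma no_EFk_outer_of_cut_labelling (R : realType) (G : multigraph) (L : Type)
    (C : {set vert G}) (lam : vert G -> L) (mu : edge G -> L) (k n t : nat)
    (E : 'I_t.+2 -> edge G) (K : multigraph) :
  t < n -> #|C| <= t -> cut_labelling C lam mu -> injective (mu \o E) ->
  refines K (subdivision (fun _ : edge G => n * t.+2 * (n * k).+1)) ->
  ~ guarantees_EFk_outer R k n K.
Proof.
set N := n * t.+2 * (n * k).+1.
move=> tn Ct clab injE [l [f [h [bij_f _ fh]]]].
have clabK := cut_labelling_iso fh (cut_labelling_subdivision (l := l)
  (cut_labelling_subdivision (l := fun=> N) clab)).
(* The vertices that the first subdivision inserts on [E j] ([inr]), kept as old vertices by the
   second one ([inl]) and pulled back to [K] along [f]. *)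
pose D (j : 'I_t.+2) := (f @^-1:
  [set inl (inr (existT (fun=> 'I_N) (E j) i)) | i : 'I_N])%SET.
apply: (no_EFk_outer_of_cut (D := D) (l := mu \o E) tn _ injE
  (fun u v uC vC => cut_labelling_adjacent clabK uC vC)).
- rewrite (on_card_preimset (onW_bij _ bij_f)).
  by rewrite !card_imset // => x y [].
- by move=> j v; rewrite inE => /imsetP[i _ /= ->].
- move=> j; rewrite (on_card_preimset (onW_bij _ bij_f)) card_imset ?card_ord //.
  move=> x y e; apply: val_inj.
  exact: (congr1 (fun w : vert (subdivision (fun _ : edge G => N)) + _ =>
    match w with inl (inr u) => nat_of_ord (tagged u) | _ => 0 end) e).
Qed.

End GraphAllocations.

(** * Coordinates on a tangle *)

Section CopyMap.
Local Open Scope classical_set_scope.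
Local Open Scope ring_scope.
Context {R : realType} (T : tangle R).

Lemma clamp_subproof (s : R) : Num.max 0 (Num.min s 1) \in (`[0, 1]%classic : set R).
Proof.
by rewrite inE /= in_itv /= le_max lexx /= ge_max ler01 ge_min lexx orbT.
Qed.

Definition clamp (s : R) : set_type (`[0, 1]%classic : set R) :=
  SigSub (clamp_subproof s).

Lemma clamp_continuous : continuous clamp.
Proof.
apply: continuous_comp_initial => s.
have -> : val \o clamp = fun s : R => Num.max 0 (Num.min s 1) by [].
apply: (@continuous_max R R (fun=> 0) (fun s => Num.min s 1)); first exact: cvg_cst.
by apply: (@continuous_min R R id (fun=> 1)); [exact: cvg_id|exact: cvg_cst].
Qed.

Lemma val_clamp (s : R) : 0 <= s <= 1 -> val (clamp s) = s.
Proof. by case/andP=> s0 s1; rewrite /= min_l // max_r. Qed.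

(** Clamping makes this parametrization of the [i]-th copy total and continuous on [R]; only
    parameters in [0, 1] are meaningful. *)
Definition copy_map (i : 'I_(ncopies T)) (s : R) : T :=
  \pi_{eq_quot glue_equiv R (gluing T)}%qT (existT _ i (clamp s)).

Definition end_coord (a : 'I_(ncopies T) * bool) : R := if a.2 then 1 else 0.

Lemma glued_endE a : glued_end R (gluing T) a = copy_map a.1 (end_coord a).
Proof.
rewrite /glued_end /copy_map /copy_end; congr (\pi_ _ (existT _ _ _))%qT.
apply: val_inj; rewrite val_clamp /end_coord; case: a.2 => //=.
- by rewrite lexx ler01.
- by rewrite lexx ler01.
Qed.

Lemma copy_map_surj (x : T) : exists i s, 0 <= s <= 1 /\ x = copy_map i s.
Proof.
have : x = \pi_{eq_quot glue_equiv R (gluing T)}%qT (repr x) by rewrite reprK.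
case: (repr x) => i s ->; exists i, (val s); split.
  by have := set_mem (valP s); rewrite /= in_itv.
rewrite /copy_map; congr (\pi_ _ (existT _ _ _))%qT.
apply: val_inj; rewrite val_clamp //.
by have := set_mem (valP s); rewrite /= in_itv.
Qed.

Lemma copy_map_continuous i : continuous (copy_map i).
Proof.
move=> s; apply: (@continuous_comp _ _ _ (fun s => existT _ i (clamp s))
  (\pi_{eq_quot glue_equiv R (gluing T)}%qT : unit_copies R (ncopies T) -> T)).
  apply: (@continuous_comp _ _ _ clamp (existT _ i)).
    exact: clamp_continuous.
  exact: existT_continuous.
exact: (@pi_continuous _ {eq_quot glue_equiv R (gluing T)}%qT).
Qed.

Lemma copy_map_eq i j s u : 0 <= s <= 1 -> 0 <= u <= 1 ->
  copy_map i s = copy_map j u ->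
  (i = j /\ s = u) \/
  exists a b, [/\ gluing T a b, i = a.1, s = end_coord a, j = b.1 & u = end_coord b].
Proof.
move=> s01 u01 e.
have /eqquotP/asboolP : (existT _ i (clamp s) = existT _ j (clamp u)
  %[mod {eq_quot glue_equiv R (gluing T)}])%qT := e.
have inj k (v : R) (x : unit_copies R (ncopies T)) : 0 <= v <= 1 ->
    existT _ k (clamp v) = x -> k = projT1 x /\ v = val (projT2 x).
  by move=> v01 <-; split=> //; rewrite val_clamp.
case=> [/(inj i s _ s01)[-> ->]|[a [b [gab /(inj i s _ s01)[-> ->] /(inj j u _ u01)[-> ->]]]]].
  by left; rewrite val_clamp.
by right; exists a, b; split=> //; rewrite /end_coord /copy_end /=; case: ifP.
Qed.

(** The topology is the quotient of a disjoint sum, so openness can be tested copy by copy in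
    coordinates. This is the form in which openness is checked below. *)
Lemma tangle_openP (U : set T) : open U <->
  (forall i (s : R), 0 <= s <= 1 -> U (copy_map i s) -> exists2 e : R, 0 < e &
    forall u : R, 0 <= u <= 1 -> `|u - s| < e -> U (copy_map i u)).
Proof.
split=> [oU i s s01 Us|HU].
  have : nbhs s (copy_map i @^-1` U).
    by apply: copy_map_continuous; apply: open_nbhs_nbhs.
  case/nbhs_ballP => e /= e0 eU; exists e => // u _ us; apply: eU.
  by rewrite /ball /= distrC.
have : open (\pi_{eq_quot glue_equiv R (gluing T)}%qT @^-1` U
   : set (unit_copies R (ncopies T))).
  apply/sigT_openP => i; rewrite openE => s Us; rewrite /interior.
  have s01 : 0 <= val s <= 1 by have := set_mem (valP s); rewrite /= in_itv.
  have clampK (v : set_type (`[0, 1]%classic : set R)) : 0 <= val v <= 1 -> clamp (val v) = v.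
    by move=> v01; apply: val_inj; rewrite val_clamp.
  have [|e e0 eU] := HU i (val s) s01; first by rewrite /copy_map clampK.
  have : nbhs s (set_val @^-1` ball (set_val s) e).
    by apply: initial_continuous; exact: nbhsx_ballx.
  apply: filterS => v /= vs.
  have v01 : 0 <= val v <= 1 by have := set_mem (valP v); rewrite /= in_itv.
  have := eU (val v) v01; rewrite /copy_map clampK //; apply.
  by move: vs; rewrite /ball /= distrC.
(* In the quotient topology a set is open by definition when its preimage is. *)
by [].
Qed.

Lemma copy_map_connected i (J : set R) : is_interval J -> connected (copy_map i @` J).
Proof.
move=> /connected_intervalP cJ; apply: connected_continuous_connected => //.
by apply: continuous_subspaceT => s; apply: copy_map_continuous.
Qed.

End CopyMap.

(** * Local structure of a tangle: isolated coordinates, open components, rays *)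

Section TangleTopology.
Local Open Scope classical_set_scope.
Local Open Scope ring_scope.

Lemma setC_seq_cons (U : choiceType) (x : U) (X : seq U) :
  ~` [set` x :: X] = (~` [set` X]) `\ x.
Proof.
apply/seteqP; split=> y; rewrite /setD /setC /= in_cons.
  by move/negP; rewrite negb_or => /andP[/eqP ? /negP ?].
by move=> [? ?]; apply/negP; rewrite negb_or; apply/andP; split; [apply/eqP|apply/negP].
Qed.

Context {R : realType} (T : tangle R).
Implicit Types (i j : 'I_(ncopies T)) (s u e : R) (x y z : T) (W A B : set T).

Lemma copy_map_interior_inj i j s u : 0 < s < 1 -> 0 <= u <= 1 ->
  copy_map i s = copy_map j u -> i = j /\ s = u.
Proof.
move=> s01 u01 /copy_map_eq[||//|[[? []] [? [_ _]]]].
- by case/andP: s01 => /ltW -> /ltW ->.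
- by [].
- by rewrite /end_coord /= => s1 _ _; move: s01; rewrite s1 ltxx andbF.
- by rewrite /end_coord /= => s1 _ _; move: s01; rewrite s1 ltxx.
Qed.

Lemma unit_interior_or_end i s : 0 <= s <= 1 ->
  0 < s < 1 \/ exists b, s = end_coord (i, b).
Proof.
move=> /andP[]; rewrite !le_eqVlt => /orP[/eqP<- _|-> /orP[/eqP->|->]].
- by right; exists false.
- by right; exists true.
- by left.
Qed.

(** On one copy, [x] has either a single interior coordinate or at most the coordinates 0 and 1; so
    few coordinates leave room around [s]. *)
Lemma copy_map_isolated x i s : 0 <= s <= 1 -> exists2 e : R, 0 < e &
  forall u : R, 0 <= u <= 1 -> `|u - s| < e -> u <> s -> copy_map i u <> x.
Proof.
move=> s01; have [[r [r01 rx]]|nr] := pselect (exists r, 0 < r < 1 /\ copy_map i r = x).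
  exists (if s == r then 1 else `|s - r|); first by case: eqP => // /eqP; rewrite normr_gt0 subr_eq0.
  move=> u u01 us neq; rewrite -rx => /esym/(copy_map_interior_inj r01 u01)[_ ru].
  move: us neq; rewrite -ru; case: eqP => [->//|_].
  by rewrite distrC ltxx.
have ends u : 0 <= u <= 1 -> copy_map i u = x -> u = 0 \/ u = 1.
  move=> /(unit_interior_or_end i)[u01 ux|[[] -> _]]; last 2 first.
  - by right.
  - by left.
  by case: nr; exists u.
(* The distance from an interior [s] to the nearer end. If [s] is itself an end, the other end is at
   distance 1, excluded by the strict inequality. *)
exists (if (0 < s) && (s < 1) then Num.min s (1 - s) else 1).
  by case: ifP => // /andP[s0 s1]; rewrite lt_min s0 subr_gt0.
move=> u u01 us neq /(ends u u01); move: us neq; case: ifP => [/andP[s0 s1]|nint].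
  by rewrite lt_min !ltr_norml => /andP[/andP[? ?] /andP[? ?]] _ []; lra.
case: (unit_interior_or_end i s01) => [|[b sb]]; first by rewrite nint.
by rewrite sb ltr_norml /end_coord /=; case: (b) => /andP[? ?] neq [] ux;
  first [by lra|case: (neq ux)].
Qed.

Lemma open_setD1 W x : open W -> open (W `\ x).
Proof.
move=> /tangle_openP oW; apply/tangle_openP => i s s01 [Ws nx].
have [e e0 eW] := oW i s s01 Ws; have [d d0 dx] := copy_map_isolated x i s01.
exists (Num.min e d); first by rewrite lt_min e0.
move=> u u01; rewrite lt_min => /andP[ue ud]; split; first exact: eW.
by have [->//|/eqP us] := eqVneq u s; apply: dx.
Qed.

Lemma open_setC_seq (X : seq T) : open (~` [set` X]).
Proof.
elim: X => [|x X IHX]; first by rewrite (_ : ~` _ = setT); [exact: openT|apply/seteqP; split].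
by rewrite (setC_seq_cons (U := T)); exact: open_setD1.
Qed.

Lemma connected_copy_map i (J : set R) W :
  is_interval J -> copy_map i @` J `<=` W ->
  forall s u, J s -> J u -> connected_component W (copy_map i s) (copy_map i u).
Proof.
move=> iJ JW s u Js Ju.
have Bs : (copy_map i @` J) (copy_map i s) by exists s.
by apply: (connected_component_max Bs JW (copy_map_connected iJ)); exists u.
Qed.

(** Local connectedness: a short interval around a coordinate stays in [W], and its image is
    connected. *)
Lemma component_open W z : open W -> open (connected_component W z).
Proof.
move=> /tangle_openP oW; apply/tangle_openP => i s s01 Cs.
have [e e0 eW] := oW i s s01 (connected_component_sub Cs).
exists e => // u u01 us; apply: connected_component_trans Cs _.
apply: (connected_copy_map (J := [set v | 0 <= v <= 1 /\ `|v - s| < e])) => /=.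
- move=> a b /= [/andP[? ?]]; rewrite ltr_norml => /andP[? ?] [/andP[? ?]].
  rewrite ltr_norml => /andP[? ?] c /andP[? ?]; rewrite ltr_norml.
  by split; apply/andP; split; lra.
- by move=> _ [v [v01 vs] <-]; apply: eW.
- by rewrite subrr normr0.
- by [].
Qed.

Lemma component_eq W x y : W x -> connected_component W x y ->
  connected_component W x = connected_component W y.
Proof. by move=> Wx; apply: same_connected_component. Qed.

(** The component of [y] is an open neighborhood of [y], so it meets any component accumulating at
    [y] and equals it. *)
Lemma component_relatively_closed W z y : open W ->
  closure (connected_component W z) y -> W y -> connected_component W z y.
Proof.
move=> oW cly Wy; have [] := cly (connected_component W y).
  apply: open_nbhs_nbhs; split; first exact: component_open.
  exact: connected_component_refl.
move=> v [zv yv]; apply: connected_component_trans zv _.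
exact: connected_component_sym.
Qed.

Lemma component_mono A W z : A `<=` W ->
  connected_component A z `<=` connected_component W z.
Proof.
move=> AW y [C [Cz CA cC] Cy]; exists C => //; split=> //.
exact: subset_trans AW.
Qed.

(* [J1] and [J2] are the two rays from [x]; the last clause says that together
   with [x] they form a neighborhood of [x]. *)
Lemma nonsingular_rays W x : open W -> W x -> ~ singular x ->
  exists J1 J2 : set T, [/\ connected J1 /\ connected J2, J1 `|` J2 `<=` W `\ x &
    forall j u, 0 <= u <= 1 -> copy_map j u = x -> exists2 e : R, 0 < e &
      forall v, 0 <= v <= 1 -> `|v - u| < e -> v <> u -> (J1 `|` J2) (copy_map j v)].
Proof.
move=> /tangle_openP oW Wx nsx.
have near i s : 0 <= s <= 1 -> copy_map i s = x -> exists2 e : R, 0 < e &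
    forall u : R, 0 <= u <= 1 -> `|u - s| < e -> u <> s -> (W `\ x) (copy_map i u).
  move=> s01 sx; have [|e e0 eW] := oW i s s01; first by rewrite sx.
  have [d d0 dx] := copy_map_isolated x i s01.
  exists (Num.min e d); first by rewrite lt_min e0.
  move=> u u01; rewrite lt_min => /andP[ue ud] us; split; first exact: eW.
  exact: dx.
(* If [x] is interior to a copy, the rays are the two sides of its coordinate; otherwise they leave
   from the two ends glued at [x]. *)
have [[i [s [sint sx]]]|nint] := pselect (exists i s, 0 < s < 1 /\ copy_map i s = x).
  have s01 : 0 <= s <= 1 by case/andP: sint => /ltW -> /ltW ->.
  have [e e0 eW] := near i s s01 sx.
  exists (copy_map i @` [set u | 0 <= u <= 1 /\ s - e < u < s]).
  exists (copy_map i @` [set u | 0 <= u <= 1 /\ s < u < s + e]).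
  split.
  - split; apply: copy_map_connected => a b /= [/andP[? ?] /andP[? ?]] [/andP[? ?] /andP[? ?]];
      by move=> c /andP[? ?]; split; apply/andP; split; lra.
  - by move=> _ [] [u [u01 /andP[? ?]] <-]; apply: eW => //;
      [rewrite ltr_norml; apply/andP; split; lra|lra|rewrite ltr_norml; apply/andP; split; lra|lra].
  - move=> j u u01; rewrite -sx => /esym/(copy_map_interior_inj sint u01)[<- <-].
    exists e => // v v01; rewrite ltr_norml => /andP[? ?] /eqP.
    rewrite neq_lt => /orP[?|?]; [left|right]; exists v => //; split=> //;
      by apply/andP; split; lra.
pose P := [set a | `[< glued_end R (gluing T) a = x >]]%SET.
have xP j u : 0 <= u <= 1 -> copy_map j u = x ->
    exists b, (j, b) \in P /\ u = end_coord (j, b).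
  move=> u01 ux; case: (unit_interior_or_end j u01) => [uint|[b ub]].
    by case: nint; exists j, u.
  by exists b; split=> //; rewrite inE; apply/asboolP; rewrite glued_endE /= -ub.
(* All coordinates of [x] are ends, so [P] is nonempty and the default degree 2 does not apply: the
   degree is [#|P|], neither 1 nor at least 3. *)
have /cards2P[a [b [_ Pab]]] : #|P| == 2.
  have : (#|P| > 0)%N.
    have [i [s [s01 /esym sx]]] := copy_map_surj x.
    by have [c [cP _]] := xP i s s01 sx; apply/card_gt0P; exists (i, c).
  have := nsx; rewrite /singular /= /degree.
  rewrite (_ : #|[pred _ | _]| = #|P|); last by rewrite cardsE.
  by case: #|P| => [|[|[|p]]] //= ns _; case: ns; [left|right].
have Px a' : a' \in P -> copy_map a'.1 (end_coord a') = x.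
  by rewrite inE -glued_endE => /asboolP.
have end01 (a' : 'I_(ncopies T) * bool) : 0 <= end_coord a' <= 1.
  by rewrite /end_coord; case: a'.2; rewrite ?lexx ler01.
have [aP bP] : a \in P /\ b \in P by rewrite Pab !inE !eqxx orbT.
have [ea ea0 eaW] := near _ _ (end01 a) (Px a aP).
have [eb eb0 ebW] := near _ _ (end01 b) (Px b bP).
(* A short interval at the end [a'] with that end removed; it remains an interval because the end is
   extreme in [0, 1]. *)
pose J (a' : 'I_(ncopies T) * bool) (e : R) := copy_map a'.1 @` [set u | [/\ 0 <= u <= 1, `|u - end_coord a'| < e & u <> end_coord a']].
have cJ a' e : connected (J a' e).
  apply: copy_map_connected => c d /= [/andP[? ?]]; rewrite ltr_norml => /andP[? ?] nc.
  move=> [/andP[? ?]]; rewrite ltr_norml => /andP[? ?] nd f /andP[? ?].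
  rewrite ltr_norml; split; [by apply/andP; split; lra|by apply/andP; split; lra|].
  move: nc nd; rewrite /end_coord; case: a'.2 => nc nd fw.
    by apply: nd; lra.
  by apply: nc; lra.
exists (J a ea), (J b eb); split=> //.
- by move=> _ [] [u [u01 ue us] <-]; [apply: eaW|apply: ebW].
- move=> j u u01 ux; have [c [cP ->]] := xP j u u01 ux.
  move: cP; rewrite Pab !inE => /orP[]/eqP ca.
    by exists ea => // v v01 ve vs; left; exists v; rewrite -ca.
  by exists eb => // v v01 ve vs; right; exists v; rewrite -ca.
Qed.

End TangleTopology.

(** * Removing nonsingular points from a cutset *)

Section Merging.
Local Open Scope classical_set_scope.
Local Open Scope ring_scope.
Context {R : realType} (T : tangle R).
Implicit Types (x y z : T) (W A B : set T).

(** Such a component contains all its accumulation points in [W], so it is open and closed in the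
    component of [W] around it. *)
Lemma component_setD1_far W x z : open W -> (W `\ x) z ->
  ~ closure (connected_component (W `\ x) z) x ->
  connected_component (W `\ x) z = connected_component W z.
Proof.
move=> oW W'z nclx; have oW' := open_setD1 (x := x) oW.
have sub : connected_component (W `\ x) z `<=` connected_component W z.
  by apply: component_mono => y [].
apply: component_connected; first by exists z; exact: connected_component_refl.
  exists (connected_component (W `\ x) z); first exact: component_open.
  by apply/seteqP; split=> [y Ay|y []//]; split=> //; apply: sub.
exists (closure (connected_component (W `\ x) z)); first exact: closed_closure.
apply/seteqP; split=> [y Ay|y [Wy cly]].
  by split; [exact: sub|exact: subset_closure].
apply: component_relatively_closed => //.
split; first exact: connected_component_sub Wy.
by move=> yx; apply: nclx; move: cly; rewrite yx.
Qed.

(** If the component missed [J], its complement in [W] would be a neighborhood of [x], although [x]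
    lies in its closure. *)
Lemma component_setD1_meets_ray W x z (J : set T) : open W -> W x ->
  (forall j u, 0 <= u <= 1 -> copy_map j u = x -> exists2 e : R, 0 < e &
    forall v, 0 <= v <= 1 -> `|v - u| < e -> v <> u -> J (copy_map j v)) ->
  (W `\ x) z -> closure (connected_component (W `\ x) z) x ->
  connected_component (W `\ x) z `&` J !=set0.
Proof.
move=> oW Wx Jx W'z clx; have oW' := open_setD1 (x := x) oW.
set A := connected_component (W `\ x) z.
apply: contrapT => /nonemptyPn AJ0.
have [] := clx (W `\` A).
  apply: open_nbhs_nbhs; split; last by split=> // /connected_component_sub[_]; apply.
  apply/tangle_openP => i s s01 [Ws nAs].
  have [sx|sx] := pselect (copy_map i s = x).
    have [d d0 dJ] := Jx i s s01 sx.
    have [e e0 eW] := (tangle_openP W).1 oW i s s01 Ws.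
    exists (Num.min e d); first by rewrite lt_min e0.
    move=> u u01; rewrite lt_min => /andP[ue ud]; split; first exact: eW.
    have [->//|/eqP us] := eqVneq u s => Au.
    suff : (A `&` J) (copy_map i u) by rewrite AJ0.
    by split=> //; apply: dJ.
  have [e e0 eA] := (tangle_openP _).1 (component_open (z := copy_map i s) oW') i s s01
    (connected_component_refl (conj Ws sx)).
  exists e => // u u01 us; have Cu := eA u u01 us.
  split; first by have [] := connected_component_sub Cu.
  by move=> Au; apply: nAs; apply: connected_component_trans Au (connected_component_sym Cu).
by move=> y [Ay [_]].
Qed.

(** The empty set is a placeholder for a ray met by no component that accumulates at [x], so that
    two sets can always be named. *)
Definition touching W x A := A = set0 \/
  exists z, [/\ (W `\ x) z, A = connected_component (W `\ x) z & closure A x].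

(** Each of the two rays is connected, hence meets only one component. A component accumulating at
    [x] meets a ray; one that does not is already a component of [W]. *)
Lemma nonsingular_touching W x : open W -> W x -> ~ singular x ->
  exists A B, [/\ touching W x A, touching W x B &
    forall z, (W `\ x) z -> let C := connected_component (W `\ x) z in
    [\/ C = A, C = B | C = connected_component W z]].
Proof.
move=> oW Wx nsx; have [J1 [J2 [[cJ1 cJ2] JW Jx]]] := nonsingular_rays oW Wx nsx.
have pick J : connected J -> J `<=` W `\ x -> exists2 A, touching W x A &
    forall z, (W `\ x) z -> closure (connected_component (W `\ x) z) x ->
    connected_component (W `\ x) z `&` J !=set0 -> connected_component (W `\ x) z = A.
  move=> cJ JW'.
  have [[z [W'z clx zJ]]|none] := pselect (exists z, [/\ (W `\ x) z,
      closure (connected_component (W `\ x) z) x &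
      connected_component (W `\ x) z `&` J !=set0]); last first.
    exists set0; first by left.
    by move=> z *; case: none; exists z.
  exists (connected_component (W `\ x) z); first by right; exists z.
  move=> z' W'z' _ [y' [z'y' Jy']]; case: zJ => y [zy Jy].
  apply: component_eq => //; apply: connected_component_trans z'y' _.
  apply: connected_component_trans (connected_component_sym zy).
  exact: (connected_component_max Jy' JW' cJ).
have [|A tA AE] := pick J1 cJ1; first by move=> y Jy; apply: JW; left.
have [|B tB BE] := pick J2 cJ2; first by move=> y Jy; apply: JW; right.
exists A, B; split=> // z W'z C.
have [clx|nclx] := pselect (closure C x); last by constructor 3; exact: component_setD1_far.
have [y [Cy [Jy|Jy]]] := component_setD1_meets_ray oW Wx Jx W'z clx.
  by constructor 1; apply: AE => //; exists y.
by constructor 2; apply: BE => //; exists y.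
Qed.

(** Putting [x] back discards at most the two touching components and creates the component of [x]:
    a net loss of at most one. *)
Lemma components_setU1 W x (s : seq (set T)) : open W -> W x -> ~ singular x ->
  uniq s -> (forall C : set T, C \in s -> components (W `\ x) C) ->
  exists s' : seq (set T), [/\ uniq s', (size s <= (size s').+1)%N &
    forall C : set T, C \in s' -> components W C].
Proof.
move=> oW Wx nsx us sW; have [A [B [_ _ AB]]] := nonsingular_touching oW Wx nsx.
exists (connected_component W x :: [seq C <- s | C \notin [:: A; B]]); split.
- rewrite /= filter_uniq // andbT mem_filter; apply/negP => /andP[_ /sW[z _ zE]].
  have : connected_component W x x by exact: connected_component_refl.
  by rewrite -zE => /connected_component_sub[_]; apply.
- rewrite /= -(count_predC (mem [:: A; B])) size_filter -addn2 addnC leq_add2l.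
  rewrite -size_filter; apply: (@uniq_leq_size _ _ [:: A; B]); first exact: filter_uniq.
  by move=> C; rewrite mem_filter => /andP[].
- move=> C; rewrite inE mem_filter => /orP[/eqP->|/andP[]]; first by exists x.
  rewrite !inE negb_or => /andP[CA CB] /sW[z W'z zC].
  exists z; first by case: W'z.
  by have [] := AB z W'z; rewrite zC // => CE; move: CA CB; rewrite CE eqxx.
Qed.

(** [X] may list [x] several times, so all its occurrences are filtered out. *)
Lemma setC_seq_rem (U : choiceType) (x : U) (X : seq U) : x \in X ->
  exists X0 : seq U, [/\ (size X0 < size X)%N, (~` [set` X0]) x &
    ~` [set` X] = (~` [set` X0]) `\ x].
Proof.
move=> xX; exists [seq y <- X | y != x]; split.
- rewrite -(count_predC (pred1 x) X) size_filter -[ltnLHS]add0n ltn_add2r.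
  by rewrite -has_count has_pred1.
- by rewrite /setC /= mem_filter eqxx.
- apply/seteqP; split=> y; rewrite /setD /setC /= mem_filter.
    by move=> yX; split=> [/andP[_]//|yx]; apply: yX; rewrite yx.
  by case=> yX0 yx yX; apply: yX0; rewrite yX andbT; apply/eqP.
Qed.

(** Dropping a nonsingular point shortens the list by at least one and costs at most one component,
    so the excess of two survives; induction on the length. *)
Lemma singular_cutset (X : seq T) (s : seq (set T)) :
  uniq s -> ((size X).+2 <= size s)%N ->
  (forall C : set T, C \in s -> components (~` [set` X]) C) ->
  exists (X' : seq T) (s' : seq (set T)), [/\ [set` X'] `<=` @singular R T, (size X' <= size X)%N, uniq s',
   ((size X').+2 <= size s')%N & forall C : set T, C \in s' -> components (~` [set` X']) C].
Proof.
have [n] := ubnP (size X); elim: n X s => // n IHn X s Xn us Xs sX.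
have [[x [xX nsx]]|ns] := pselect (exists x, x \in X /\ ~ singular x); last first.
  exists X, s; split=> // x xX; apply: contrapT => nsx.
  by apply: ns; exists x.
have [X0 [szX0 xX0 XE]] := setC_seq_rem xX.
rewrite XE in sX.
have [s0 [us0 ss0 sX0]] := components_setU1 (open_setC_seq (X := X0)) xX0 nsx us sX.
have [||X' [s' [? le_X' ? ? ?]]] := IHn X0 s0 _ us0 _ sX0.
- exact: leq_trans szX0 _.
- by rewrite -ltnS; apply: leq_trans ss0; apply: leq_trans Xs; rewrite !ltnS.
by exists X', s'; split=> //; apply: leq_trans le_X' (ltnW szX0).
Qed.

End Merging.

(** * The graph of a tangle *)

Section EdgeEnds.
Local Open Scope classical_set_scope.
Local Open Scope ring_scope.
Context {R : realType} (T : tangle R).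
Implicit Types (x y z : T) (W A B : set T).

(** An inclusion, since the boundary is a single point for a loop and empty for a whole circle. *)
Definition at_most_two_ends W := forall z, W z -> exists p q : T,
  closure (connected_component W z) `\` connected_component W z `<=` [set p; q].

Lemma closed_set1_tangle x : closed [set x].
Proof.
rewrite -[X in closed X]setCK closedC -setTD.
by apply: open_setD1; exact: openT.
Qed.

(** The component of [x] in [W] consists of [x] and at most two touching components. Each of these
    has [x] among its at most two ends, which leaves one further end each. Components avoiding [x]
    do not change. *)
Lemma at_most_two_ends_setU1 W x : open W -> W x -> ~ singular x ->
  at_most_two_ends (W `\ x) -> at_most_two_ends W.
Proof.
move=> oW Wx nsx PW' z Wz; set D := connected_component W z.
have [Dx|nDx] := pselect (D x); last first.
  have sub : D `<=` W `\ x.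
    move=> y Dy; split; first exact: connected_component_sub Dy.
    by move=> yx; apply: nDx; rewrite -yx.
  have Dz : D z by exact: connected_component_refl.
  have [p [q pq]] := PW' z (sub _ Dz); exists p, q.
  suff -> : D = connected_component (W `\ x) z by [].
  apply/seteqP; split.
    exact: (connected_component_max Dz sub (@component_connected _ _ _)).
  by apply: component_mono => y [].
have oD : open D by exact: component_open.
have half C : touching W x C -> exists r : T, closure C `\` D `<=` [set r].
  case=> [->|[z' [W'z' -> clx]]]; first by exists x; rewrite closure0 set0D.
  set A := connected_component _ _ in clx *.
  have AD : A `<=` D.
    have [y [Ay Dy]] : A `&` D !=set0 by apply: clx; exact: open_nbhs_nbhs.
    move=> v Av; apply: connected_component_trans Dy _.
    apply: (component_mono (A := W `\ x)); first by move=> ? [].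
    by apply: connected_component_trans Av; exact: connected_component_sym.
  have [p [q pq]] := PW' z' W'z'.
  have nAx : ~ A x by move=> /connected_component_sub[_]; apply.
  have xpq : [set p; q] x by apply: pq; split.
  (* One of [p], [q] is [x], which is absorbed into [D]; the other is the remaining end. *)
  exists (if p == x then q else p) => y [cly nDy].
  have : [set p; q] y by apply: pq; split=> // /AD.
  have yx : y <> x by move=> yx; apply: nDy; rewrite yx.
  case: eqP => [px|px]; first by case=> // yp; case: yx; rewrite yp.
  by case: xpq => [/esym//|xq] [//|yq]; case: yx; rewrite yq xq.
have [A [B [/half[p Ap] /half[q Bq] AB]]] := nonsingular_touching oW Wx nsx.
exists p, q => y [cly nDy].
have DAB : D `<=` [set x] `|` (A `|` B).
  move=> v Dv; have [->|vx] := pselect (v = x); first by left.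
  have W'v : (W `\ x) v by split=> //; exact: connected_component_sub Dv.
  have Cv : connected_component (W `\ x) v v by exact: connected_component_refl.
  have [CA|CB|CE] := AB v W'v; [by right; left; rewrite -CA|by right; right; rewrite -CB|].
  have : connected_component (W `\ x) v x.
    by rewrite CE; apply: connected_component_trans Dx; exact: connected_component_sym.
  by move=> /connected_component_sub[_]; case.
have := closureS DAB cly; rewrite !closureU => -[|[clA|clB]].
- rewrite -(closure_id _).1; last exact: closed_set1_tangle.
  by move=> yx; case: nDy; rewrite yx.
- by left; apply: Ap.
- by right; apply: Bq.
Qed.

Lemma at_most_two_ends_setU_seq W (l : seq T) : open W ->
  (forall x, x \in l -> ~ singular x) ->
  at_most_two_ends (W `\` [set` l]) -> at_most_two_ends W.
Proof.
move=> oW; elim: l => [_|x l IHl nsl]; first by rewrite set_nil setD0.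
rewrite setDE (setC_seq_cons (U := T)) setDE setIA -!setDE => Pl.
apply: IHl => [y yl|]; first by apply: nsl; rewrite inE yl orbT.
have [Wx|nWx] := pselect ((W `\` [set` l]) x).
  apply: at_most_two_ends_setU1 Pl => //; last by apply: nsl; rewrite inE eqxx.
  by rewrite setDE; apply: openI => //; exact: open_setC_seq.
(* Here [x] lies outside [W] or occurs again in [l], so removing it changes nothing. *)
suff E : (W `\` [set` l]) `\ x = W `\` [set` l] by rewrite -[X in at_most_two_ends X]E.
by apply/seteqP; split=> [y []//|y Wy]; split=> // yx; apply: nWx; rewrite -yx.
Qed.

(** Other copies meet this one only at the images of 0 and 1, and these are isolated in
    coordinates. *)
Lemma closed_copy i : closed (copy_map i @` [set s : R | 0 <= s <= 1] : set T).
Proof.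
rewrite -[X in closed X]setCK closedC; apply/tangle_openP => j s s01 nIs.
have [d d0 dp] := copy_map_isolated (copy_map i 0 : T) j s01.
have [e e0 eq] := copy_map_isolated (copy_map i 1 : T) j s01.
exists (Num.min d e); first by rewrite lt_min d0.
move=> u u01; rewrite lt_min => /andP[ud ue].
have [->//|/eqP us] := eqVneq u s => -[v v01 vu].
have [[ij _]|[a [b [_ ia va _ _]]]] := copy_map_eq v01 u01 vu.
  by apply: nIs; exists s; rewrite ?ij.
move: va vu; rewrite /end_coord; case: a.2 => ->; [exact/nesym/eq|exact/nesym/dp].
Qed.

Lemma open_copy_interior i : open (copy_map i @` [set s : R | 0 < s < 1] : set T).
Proof.
apply/tangle_openP => j s s01 [v v01 /(copy_map_interior_inj v01 s01)[<- vs]].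
case/andP: v01; rewrite vs => s0 s1.
exists (Num.min s (1 - s)); first by rewrite lt_min s0 subr_gt0.
move=> u u01; rewrite lt_min !ltr_norml => /andP[/andP[? ?] /andP[? ?]].
by exists u => //=; apply/andP; split; lra.
Qed.

(** Away from all ends, a component has the same trace on the open copy and on the closed copy
    through [z]. That trace is open and closed, so the component lies in one open copy, and its
    closure adds at most the images of 0 and 1. *)
Lemma at_most_two_ends_copies : at_most_two_ends (~` range (glued_end R (gluing T))).
Proof.
set E := range _; move=> z nEz.
have endE i b : E (copy_map i (end_coord (i, b))) by exists (i, b); rewrite ?glued_endE.
have oE : open (~` E).
  have /finite_seqP[l ->] : finite_set E by apply: finite_image; exact: finite_finset.
  exact: open_setC_seq.
have [i [s [s01 zE]]] := copy_map_surj z.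
have sint : 0 < s < 1.
  case: (unit_interior_or_end i s01) => // -[b sb]; case: nEz.
  by rewrite zE sb; exact: endE.
exists (copy_map i 0), (copy_map i 1).
set C := connected_component _ z.
have IO y : C y -> (copy_map i @` [set s : R | 0 <= s <= 1]) y ->
    (copy_map i @` [set s : R | 0 < s < 1]) y.
  move=> /connected_component_sub nEy [v v01 vy].
  case: (unit_interior_or_end i v01) => [vint|[b vb]]; first by exists v.
  by case: nEy; rewrite -vy vb; exact: endE.
have OI : copy_map i @` [set s : R | 0 < s < 1] `<=` copy_map i @` [set s : R | 0 <= s <= 1].
  by move=> _ [v /andP[v0 v1] <-]; exists v => //=; rewrite !ltW.
have CO : C `&` (copy_map i @` [set s : R | 0 < s < 1]) = C.
  apply: component_connected.
  - by exists z; split; [exact: connected_component_refl|rewrite zE; exists s].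
  - by exists (copy_map i @` [set s : R | 0 < s < 1]) => //; exact: open_copy_interior.
  - exists (copy_map i @` [set s : R | 0 <= s <= 1]); first exact: closed_copy.
    by apply/seteqP; split=> y [Cy]; [move=> /OI|move=> /(IO y Cy)].
move=> y [cly nCy].
have : (copy_map i @` [set s : R | 0 <= s <= 1]) y.
  rewrite ((closure_id _).1 (closed_copy (i := i))).
  by apply: closureS cly => w; rewrite -CO => -[_ /OI].
case=> v v01 vy; have [vint|[b vb]] := unit_interior_or_end i v01; last first.
  by rewrite -vy vb /end_coord /=; case: b {vb}; [right|left].
case: nCy; apply: component_relatively_closed => // -[a _].
rewrite glued_endE -vy => /esym/(copy_map_interior_inj vint) [|_ va].
  by rewrite /end_coord; case: a.2; rewrite ?lexx ler01.
by move: vint; rewrite va /end_coord; case: a.2; rewrite ltxx ?andbF.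
Qed.

Lemma singular_sub_ends : @singular R T `<=` range (glued_end R (gluing T)).
Proof.
move=> x; rewrite /singular /= /degree.
(* Where no end is glued ([d = 0]) the degree takes its default value 2, which is not singular. *)
set d := #|_|; case: (posnP d) => [_ []//|].
by rewrite /d => /card_gt0P[a] ax _; exists a => //; exact/asboolP.
Qed.

Lemma finite_singular : finite_set (@singular R T).
Proof.
by apply: sub_finite_set singular_sub_ends _; apply: finite_image; exact: finite_finset.
Qed.

Lemma open_setC_singular : open (~` @singular R T).
Proof. by have /finite_seqP[l ->] := finite_singular; exact: open_setC_seq. Qed.

(** Starting from [at_most_two_ends_copies], the finitely many nonsingular ends are put back one at
    a time. *)
Lemma at_most_two_ends_singular : at_most_two_ends (~` @singular R T).
Proof.
have /finite_seqP[l lE] : finite_set (range (glued_end R (gluing T)) `\` @singular R T).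
  by apply: finite_setD; apply: finite_image; exact: finite_finset.
apply: (at_most_two_ends_setU_seq (l := l)); first exact: open_setC_singular.
  by move=> x xl; have : [set` l] x by []; rewrite -lE => -[].
rewrite -lE; set W := _ `\` _.
suff -> : W = ~` range (glued_end R (gluing T)) by exact: at_most_two_ends_copies.
apply/seteqP; split=> x; first by move=> [nsx nE] Ex; apply: nE.
by move=> nEx; split=> [/singular_sub_ends//|[]].
Qed.

(** The boundary of an edge is nonempty: otherwise the edge would be open and closed in the
    connected tangle, leaving no singular point. A candidate end outside the boundary is replaced by
    the other one, which yields a loop. *)
Lemma edge_ends z : @singular R T !=set0 -> ~ singular z -> exists p q : T,
  [/\ singular p, singular q & [set p; q] =
    closure (connected_component (~` @singular R T) z) `\`
    connected_component (~` @singular R T) z].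
Proof.
move=> [x sx] nsz; set C := connected_component _ z.
have [p [q pq]] := at_most_two_ends_singular nsz; rewrite -/C in pq.
have bdS : closure C `\` C `<=` @singular R T.
  move=> y [cly nCy]; apply: contrapT => nsy; apply: nCy.
  exact: (component_relatively_closed open_setC_singular).
have [r [clr nCr]] : closure C `\` C !=set0.
  apply: contrapT => /nonemptyPn bd0.
  have clC : closure C `<=` C.
    by move=> y cly; apply: contrapT => nCy; have : (closure C `\` C) y by []; rewrite bd0.
  have CT : C = setT.
    have cT : connected [set: T] := @tangle_connected R T.
    apply: cT; first by exists z; exact: connected_component_refl.
      by exists C; [exact: (component_open open_setC_singular)|rewrite setTI].
    by exists C; [|rewrite setTI].
  have : C x by rewrite CT.
  by move=> /connected_component_sub; apply.
have exact_pair a b : (closure C `\` C) a -> (closure C `\` C) b ->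
    closure C `\` C `<=` [set a; b] -> exists p q : T,
    [/\ singular p, singular q & [set p; q] = closure C `\` C].
  move=> bda bdb bdab; exists a, b; split; [exact: bdS|exact: bdS|].
  by apply/seteqP; split=> // y [->|->].
have [bdp|nbdp] := pselect ((closure C `\` C) p); last first.
  apply: (exact_pair r r) => // y bdy.
  have rq : r = q by case: (pq r (conj clr nCr)) => // rp; case: nbdp; rewrite -rp.
  by left; case: (pq y bdy) => [yp|->//]; case: nbdp; rewrite -yp.
have [bdq|nbdq] := pselect ((closure C `\` C) q); first exact: (exact_pair p q).
apply: (exact_pair p p) => // y bdy.
by left; case: (pq y bdy) => // yq; case: nbdq; rewrite -yq.
Qed.

(** An open component reaching a copy contains interior points of it, hence the whole open copy; the
    midpoint serves as canonical witness. *)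
Lemma component_meets_copy W z : open W -> W z ->
  (forall i s, 0 < s < 1 -> W (copy_map i s)) ->
  exists i, connected_component W z (copy_map i 2^-1).
Proof.
move=> oW Wz Wint; have [i [s [s01 zE]]] := copy_map_surj z.
have Cz : connected_component W z (copy_map i s).
  by rewrite -zE; exact: connected_component_refl.
have [e e0 eC] := (tangle_openP _).1 (component_open oW) i s s01 Cz.
exists i.
have [u [uint us]] : exists u : R, 0 < u < 1 /\ `|u - s| < e.
  (* If [s] is an end, moving inwards by [d] stays strictly within [e] of it and short of the
     opposite end. *)
  pose d := Num.min (e / 2) 2^-1.
  have d0 : 0 < d by rewrite lt_min divr_gt0 //= invr_gt0.
  have [de d1] : d <= e / 2 /\ d <= 2^-1 by rewrite !ge_min !lexx orbT.
  case: (unit_interior_or_end i s01) => [sint|[b sb]]; first by exists s; rewrite subrr normr0.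
  exists (if b then 1 - d else d); rewrite sb /end_coord /= ltr_norml.
  by case: (b); split; apply/andP; split; lra.
apply: (connected_component_trans (eC u _ us)); first by case/andP: uint => /ltW-> /ltW->.
apply: (connected_copy_map (J := [set v | 0 < v < 1])) => //.
- by move=> a b /= /andP[? ?] /andP[? ?] c /andP[? ?]; apply/andP; split; lra.
- by move=> _ [v vint <-]; exact: Wint.
- by apply/andP; split; lra.
Qed.

End EdgeEnds.

(** * Existence of the graph of a tangle and the labelling given by a cutset *)

Section TangleGraph.
Local Open Scope classical_set_scope.
Local Open Scope ring_scope.

Lemma uniq_const_size (U : eqType) (a : U) (s : seq U) :
  uniq s -> (forall x, x \in s -> x = a) -> (size s <= 1)%N.
Proof.
move=> us sa; apply: (@uniq_leq_size _ _ [:: a]) => // x /sa ->.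
by rewrite inE.
Qed.

Lemma finite_set_ord_bij (U : choiceType) (A : set U) : finite_set A ->
  exists n (f : 'I_n -> U), set_bij [set: 'I_n] A f.
Proof.
move=> /finite_seqP[l ->]; exists (size (undup l)), (tnth (in_tuple (undup l))).
split=> [i _|i j _ _|x xl] /=.
- by rewrite -mem_undup; exact: mem_tnth.
- by move/tuple_uniqP: (undup_uniq l : uniq (in_tuple (undup l))); apply.
- have : x \in in_tuple (undup l) by rewrite mem_undup.
  by move=> /tnthP[i ->]; exists i.
Qed.

Lemma card_eq_seq (U : choiceType) (A : set U) (t : nat) : (A #= `I_t)%card ->
  exists2 l : seq U, A = [set` l] & (size l <= t)%N.
Proof.
move=> At; have /finite_seqP[l AE] : finite_set A by apply/finite_setP; exists t.
have /card_set_bijP[f [fA f_inj _]] := At.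
exists (undup l); first by rewrite AE; apply/seteqP; split=> x /=; rewrite mem_undup.
rewrite -(size_map f) -(size_iota 0 t); apply: uniq_leq_size.
  rewrite map_inj_in_uniq ?undup_uniq // => x y; rewrite !mem_undup => xl yl.
  by apply: f_inj; rewrite inE AE.
move=> _ /mapP[x + ->]; rewrite mem_undup mem_iota add0n => xl.
by apply: fA; rewrite AE.
Qed.

Lemma card_ge_seq (U : pointedType) (A : set U) (t : nat) : (`I_t #<= A)%card ->
  exists s : seq U, [/\ uniq s, size s = t & forall x, x \in s -> A x].
Proof.
move=> /pcard_leP[f]; exists (map f (iota 0 t)); split.
- rewrite map_inj_in_uniq ?iota_uniq // => x y; rewrite !mem_iota !add0n => xt yt.
  by apply: inj; rewrite inE.
- by rewrite size_map size_iota.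
- by move=> _ /mapP[x + ->]; rewrite mem_iota add0n => xt; apply: funS.
Qed.

Context {R : realType} (T : tangle R).
Notation sing := (@singular R T).

Lemma interior_nonsingular i (s : R) : 0 < s < 1 -> ~ sing (copy_map i s).
Proof.
move=> s01 /singular_sub_ends[a _]; rewrite glued_endE => /esym.
case/(copy_map_interior_inj s01) => [|_ sa].
  by rewrite /end_coord; case: a.2; rewrite ?lexx ler01.
by move: s01; rewrite sa /end_coord; case: a.2; rewrite ltxx ?andbF.
Qed.

(** Each edge contains the midpoint of some copy, so there are no more edges than copies. *)
Lemma finite_edges : finite_set (components (~` sing)).
Proof.
pose c (i : 'I_(ncopies T)) := connected_component (~` sing) (copy_map i 2^-1).
apply: (@sub_finite_set _ _ (range c)); last first.
  by apply: finite_image; exact: finite_finset.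
move=> _ [z nsz <-].
have [i zi] := component_meets_copy (open_setC_singular (T := T)) nsz (@interior_nonsingular).
by exists i => //; rewrite /c (component_eq nsz zi).
Qed.

Lemma tangle_graph_exists : sing !=set0 ->
  exists (a b : nat) (p : 'I_a -> T) (c : 'I_b -> set T) (sr tg : 'I_b -> 'I_a),
    [/\ set_bij [set: 'I_a] sing p, set_bij [set: 'I_b] (components (~` sing)) c &
     forall e, [set p (sr e); p (tg e)] = closure (c e) `\` c e].
Proof.
move=> sing0.
have [a [p bp]] := finite_set_ord_bij (@finite_singular R T).
have [b [c bc]] := finite_set_ord_bij finite_edges.
have [_ _ p_surj] := bp; have [c_comp _ _] := bc.
have ends e : exists uv : 'I_a * 'I_a,
    [set p uv.1; p uv.2] = closure (c e) `\` c e.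
  have [z nsz <-] := c_comp e I.
  have [_ [_ [/p_surj[u _ <-] /p_surj[v _ <-] uvE]]] := edge_ends sing0 nsz.
  by exists (u, v).
have [f fE] := choice ends.
by exists a, b, p, c, (fun e => (f e).1), (fun e => (f e).2).
Qed.

(** Labels are the components left by [X]; an edge gets the one containing it. It agrees with the
    label of an end outside [X], because that end is in the closure of the edge and its component is
    open. Every component contains a midpoint of a copy, hence an edge. *)
Lemma cutset_labelling (G : multigraph) (p : vert G -> T) (c : edge G -> set T)
    (X : set T) :
  set_bij [set: vert G] sing p -> set_bij [set: edge G] (components (~` sing)) c ->
  (forall e, [set p (src e); p (tgt e)] = closure (c e) `\` c e) ->
  X `<=` sing -> open (~` X) ->
  exists mu : edge G -> set T,
    cut_labelling [set v | `[< X (p v) >]]%SET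
      (fun v => connected_component (~` X) (p v)) mu /\
    forall C, components (~` X) C -> exists e, mu e = C.
Proof.
move=> bp [c_comp _ c_surj] ends Xsing oX.
have XsingC : ~` sing `<=` ~` X by move=> y nsy /Xsing.
have point_of e : exists z, ~ sing z /\ c e = connected_component (~` sing) z.
  by have [z nsz <-] := c_comp e I; exists z.
have [z zP] := choice point_of.
exists (fun e => connected_component (~` X) (z e)); split.
  move=> e v ve; rewrite inE => /asboolP nXv.
  have [nsz cE] := zP e.
  have [clv _] : (closure (c e) `\` c e) (p v).
    by move: ve; rewrite -ends !inE => /orP[]/eqP->; [left|right].
  have [y [cy vy]] : c e `&` connected_component (~` X) (p v) !=set0.
    apply: clv; apply: open_nbhs_nbhs; split; first exact: component_open.
    exact: connected_component_refl.
  rewrite (component_eq nXv vy); apply/esym.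
  apply: component_eq; first exact: XsingC.
  by apply: (component_mono XsingC); rewrite -cE.
move=> C [x nXx <-].
have [|i xi] := component_meets_copy oX nXx.
  by move=> i s /interior_nonsingular/XsingC.
have half01 : 0 < (2^-1 : R) < 1.
  by apply/andP; split; lra.
have [|e _ eE] := c_surj (connected_component (~` sing) (copy_map i 2^-1)).
  by exists (copy_map i 2^-1) => //; exact: interior_nonsingular.
exists e; rewrite (component_eq nXx xi); apply: component_eq.
  by apply: XsingC; case: (zP e).
apply: (component_mono XsingC); rewrite -(zP e).2 eE.
by apply: connected_component_refl; exact: interior_nonsingular.
Qed.

End TangleGraph.

(** * Transfer of a gap cutset to all sufficiently fine subdivisions *)

Theorem theorem7p9 (R : realType) (T : tangle R)
  (hfail : exists n' : nat, (0 < n')%N /\ ~ guarantees_EF T n')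
  (k : nat) (hk : (0 < k)%N)
  (n : nat) (hn : (gap_threshold T < (n%:R)%:E)%E) :
  eventually_all T (fun K => ~ guarantees_EFk_outer R k n K).
Proof.
have [_ [t [X0 [X0t gapX0]] <-]] := ereal_inf_lt hn; rewrite lte_fin ltr_nat => tn.
have [l0 X0E l0t] := card_eq_seq X0t.
have [s0 [us0 ss0 s0X]] := card_ge_seq gapX0; rewrite X0E in s0X.
have [|X [s [Xsing szX us ss sX]]] := singular_cutset us0 _ s0X.
  by rewrite ss0 !ltnS.
(* With no point removed, the connected tangle has one component, fewer than two. So the reduced
   cutset is nonempty, and its points are singular. *)
have sing0 : (@singular R T !=set0)%classic.
  case: X Xsing ss sX {szX} => [_ ss sX|x X Xsing _ _]; last first.
    by exists x; apply: Xsing; exact: mem_head.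
  have setTE C : C \in s -> C = setT.
    move=> /sX[z _ <-]; apply/seteqP; split=> // y _.
    apply: (connected_component_max (B := setT)) => //.
    by have cT : connected [set: T] := @tangle_connected R T.
  by have := leq_trans ss (uniq_const_size us setTE).
have [a [b [p [c [sr [tg [bp bc ends]]]]]]] := tangle_graph_exists sing0.
pose G := Multigraph sr tg.
have tG : is_tangle_graph T G.
  by exists (@singular R T), p, c; split=> //; left.
have [mu [clab muP]] := cutset_labelling (G := G) bp bc ends Xsing (open_setC_seq (X := X)).
(* The reduced cutset may have become smaller than [t]; from here on its own size counts, and one
   edge is chosen in each of [t'.+2] components. *)
set t' := size X in ss szX.
have /choice[E muE] (j : 'I_t'.+2) : exists e, mu e = nth set0 s j.
  by apply: muP; apply: sX; apply: mem_nth; apply: leq_trans ss.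
exists (subdivision (fun _ : edge G => n * t'.+2 * (n * k).+1)).
  by exists G => //; exists (fun=> n * t'.+2 * (n * k).+1); exact: multigraph_iso_refl.
move=> K _ refK.
apply: (no_EFk_outer_of_cut_labelling (E := E) _ _ clab _ refK).
- exact: leq_ltn_trans (leq_trans szX l0t) tn.
(* The injective map [p] sends the cut vertices into the list [X]. *)
- rewrite cardE -(size_map p); apply: uniq_leq_size.
    rewrite map_inj_in_uniq ?enum_uniq // => u v _ _.
    by case: bp => _ p_inj _; apply: p_inj; rewrite inE.
  by move=> _ /mapP[v + ->]; rewrite mem_enum inE => /asboolP.
- move=> i j /=; rewrite !muE => /eqP; rewrite nth_uniq //.
  + by move=> /eqP /val_inj.
  + exact: leq_trans ss.
  + exact: leq_trans ss.
Qed.
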